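(* Let $X$ be a finite set of positive real numbers with $|X|\ge 2$. Then there exist $z,z'\in X$ such that \[ \left|\frac{(zX+1)^{(2)}(z'X+1)^{(2)}}{(zX+1)^{(2)}(z'X+1)}\right| \gtrsim |X|^{5/2}. \]
   Context: For $z\in\mathbb{R}$ and $X \subset \mathbb{R}$, $zX+1=\{zx+1:x\in X\}$. For sets $A,B$ of reals, $AB=\{ab:a\in A,b\in B\}$, $A^{(k)}=\{a_1\cdots a_k: a_1,\dots,a_k\in A\}$ is the $k$-fold product set, and $\frac{A}{B}=\{a/b: a\in A, b\in B\}$ (for $0\notin B$). $|\cdot|$ is cardinality. $X\gtrsim Y$ means that there are absolute constants $C,c>0$ such that $X\ge C\,Y/(\log_2 Y)^c$. *)

(* Defs.v *)
From HB Require Import structures.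
From mathcomp Require Import all_boot all_order all_algebra finmap.
From mathcomp Require Import reals exp.

Set Implicit Arguments.
Unset Strict Implicit.
Unset Printing Implicit Defensive.

Import Order.TTheory GRing.Theory Num.Theory.

Local Open Scope fset_scope.
Local Open Scope ring_scope.

Section SetArithmetic.
Variable R : realType.
Implicit Types (A B X : {fset R}) (x y z C c : R).

Definition affine_image z X : {fset R} := [fset z * x + 1 | x in X].

Definition prod_set A B : {fset R} := [fset a * b | a in A, b in B].

(* Only meaningful for 0 \notin B: division is total, with a / 0 = 0. *)
Definition ratio_set A B : {fset R} := [fset a / b | a in A, b in B].

(* {ffun 'I_k -> A} is the finite type of k-tuples of elements of A, so the
   same element may be repeated. *)
Definition kfold_prod_set A (k : nat) : {fset R} :=
  [fset \prod_(i < k) fsval ((a : {ffun 'I_k -> A}) i) | a in {: {ffun 'I_k -> A}}].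

Lemma kfold_prod_set2 A : kfold_prod_set A 2 = prod_set A A.
Proof.
apply/fsetP => y; apply/imfsetP/imfset2P => /=.
- case=> a _ ->; exists (fsval (a ord0)); first exact: fsvalP.
  exists (fsval (a ord_max)); first exact: fsvalP.
  by rewrite big_ord_recl big_ord1; congr (_ * fsval (a _)); apply: val_inj.
- case=> a aA [b bA ->].
  exists [ffun i : 'I_2 => if i == ord0 then [` aA] else [` bA]] => //.
  by rewrite big_ord_recl big_ord1 !ffunE.
Qed.

Definition log2 x : R := ln x / ln 2.

(* "x >~ y" with the implied constants C and c made explicit; to be absolute
   they have to be quantified before everything x and y depend on. *)
Definition gtrsim C c x y : Prop := C * y / (log2 y) `^ c <= x.

End SetArithmetic.

(* Main.v *)
Require Import Defs.
From HB Require Import structures.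
From mathcomp Require Import all_boot all_order all_algebra finmap.
From mathcomp Require Import reals exp.
From mathcomp Require Import zify ring lra.

Set Implicit Arguments.
Unset Strict Implicit.
Unset Printing Implicit Defensive.

Import Order.TTheory GRing.Theory Num.Theory.

Local Open Scope fset_scope.
Local Open Scope ring_scope.

(* Write G_u(x) = (ux+1)/(zx+1), which is increasing in x when z < u. Thin out X
   to every other element x_0 < x_1 < ... of its increasing enumeration, let z, w
   be consecutive among these with w/z minimal, and let u be the element of X
   between them. For v = u or w minimality gives
   (z x_j + 1) G_v(x_j) = v x_j + 1 <= z x_(j+1) + 1, so the products
   (z x_j + 1) G_v(x_i) (G_v(x_(k+1)) / G_v(x_k)) with k, i < j and last factor at
   most G_v(x_(i+1)) / G_v(x_i) lie in disjoint windows, and all of them belong to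
   the set to be bounded. Hence it remains to find, for one of the two v, about
   |X|^(3/2) pairs of an index i and a distinct quotient of consecutive values of
   G_v not exceeding the i-th one. Since G_w is a nontrivial affine function of
   G_u fixing 1, the pair of i-th quotients for G_u and G_w determines i; so for
   most i one of the two quotients has rank at least about |X|^(1/2). *)

(** * Ranks in finite sets and products in disjoint windows *)

Section Rank.
Variable R : realType.
Implicit Types (E : {fset R}) (a b : R).

Definition rank E a : nat := #|[set w : E | fsval w <= a]|.

Lemma rank_lt E a b : b \in E -> a < b -> (rank E a < rank E b)%N.
Proof.
move=> bE ab; apply/proper_card/properP; split.
  by apply/subsetP => w; rewrite !inE => /le_trans -> //; exact: ltW.
by exists [` bE]; rewrite !inE /= ?lexx // -ltNge.
Qed.

Lemma rank_inj E a b : a \in E -> b \in E -> rank E a = rank E b -> a = b.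
Proof.
move=> aE bE eqr; case: (ltgtP a b) => // /rank_lt lt.
- by have := lt _ bE; rewrite eqr ltnn.
- by have := lt _ aE; rewrite eqr ltnn.
Qed.

Lemma rank_gt0 E a : a \in E -> (0 < rank E a)%N.
Proof. by move=> aE; apply/card_gt0P; exists [` aE]; rewrite inE /=. Qed.

(* At most [s ^ 2] indices can have both ranks at most [s]. *)
Lemma sum_rank_ge (q s : nat) (e1 e2 : 'I_q -> R) :
  injective (fun i => (e1 i, e2 i)) -> (2 * s ^ 2 <= q)%N ->
  (q * s.+1 <= 2 * (\sum_i rank [fset e1 k | k : 'I_q] (e1 i)
                  + \sum_i rank [fset e2 k | k : 'I_q] (e2 i)))%N.
Proof.
move=> inj_e sq.
set E1 := [fset e1 k | k : 'I_q]; set E2 := [fset e2 k | k : 'I_q].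
have in1 i : e1 i \in E1 by apply/imfsetP; exists i.
have in2 i : e2 i \in E2 by apply/imfsetP; exists i.
pose S := [set i | (rank E1 (e1 i) <= s)%N && (rank E2 (e2 i) <= s)%N].
have cardS : (#|S| <= s ^ 2)%N.
  pose p i : 'I_s.+1 * 'I_s.+1 := (inord (rank E1 (e1 i)), inord (rank E2 (e2 i))).
  have p_inj : {in S &, injective p}.
    move=> i k; rewrite !inE => /andP[i1 i2] /andP[k1 k2] [].
    move=> /(congr1 val); rewrite /= !inordK // => /(rank_inj (in1 _) (in1 _)) eq1.
    move=> /(congr1 val); rewrite /= !inordK // => /(rank_inj (in2 _) (in2 _)) eq2.
    by apply: inj_e; rewrite eq1 eq2.
  rewrite -(card_in_imset p_inj).
  (* Ranks of members are positive, so both coordinates avoid 0; this gives s^2 instead of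
     (s+1)^2. *)
  have sub : p @: S \subset setX [set~ ord0] [set~ ord0].
    apply/subsetP => _ /imsetP[i + ->]; rewrite !inE => /andP[i1 i2].
    by rewrite -!val_eqE /= !inordK // -!lt0n !rank_gt0.
  by have := subset_leq_card sub; rewrite cardsX !cardsC1 card_ord mulnn.
have cardC : (#|S| + #|~: S| = q)%N by rewrite cardsC card_ord.
(* Outside [S] one of the two ranks is at least s+1, and 2 s^2 <= q leaves at least half of the
   indices there. *)
have lb : (#|~: S| * s.+1 <= \sum_i (rank E1 (e1 i) + rank E2 (e2 i)))%N.
  rewrite -sum_nat_const (bigID (mem (~: S)) predT) /=.
  apply: leq_trans (leq_addr _ _); apply: leq_sum => i.
  rewrite !inE negb_and -!ltnNge => /orP[] lt.
  - exact: leq_trans lt (leq_addr _ _).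
  - exact: leq_trans lt (leq_addl _ _).
have half : (q <= 2 * #|~: S|)%N by move: cardS cardC sq; lia.
rewrite -big_split /=; apply: leq_trans (leq_mul half (leqnn s.+1)) _.
by rewrite -mulnA leq_mul2l.
Qed.

(* The product [f j * g i * w] lies in the window (f j, f j.+1], and after
   division by [f j] in the window (g i, g i.+1]; so it determines j, i and w. *)
Lemma squeeze (q : nat) (f g : nat -> R) (K : {fset R}) :
  (forall j, (j < q)%N -> 0 < f j) ->
  (forall j, (j < q)%N -> f j * g q <= f j.+1) ->
  1 <= g 0%N ->
  (forall i, (i < q)%N -> g i < g i.+1) ->
  (forall j i k, (j < q)%N -> (i < q)%N -> (k < q)%N ->
     f j * g i * (g k.+1 / g k) \in K) ->
  (q * \sum_(i < q) rank [fset g (k : 'I_q).+1 / g k | k : 'I_q] (g i.+1 / g i)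
     <= #|` K|)%N.
Proof.
move=> f_gt0 f_step g0 g_step inK; set E := [fset g (k : 'I_q).+1 / g k | k : 'I_q].
have g_mono i k : (i <= k)%N -> (k <= q)%N -> g i <= g k.
  elim: k => [|k IH]; first by rewrite leqn0 => /eqP ->.
  rewrite leq_eqVlt => /orP[/eqP -> //|ik kq].
  by apply: le_trans (IH ik (ltnW kq)) _; apply/ltW/g_step.
have g_ge1 i : (i <= q)%N -> 1 <= g i by move=> iq; apply: le_trans g0 (g_mono _ _ _ iq).
have g_gt0 i : (i <= q)%N -> 0 < g i by move=> iq; apply: lt_le_trans (g_ge1 _ iq).
have f_mono i k : (i <= k)%N -> (k < q)%N -> f i <= f k.
  elim: k => [|k IH]; first by rewrite leqn0 => /eqP ->.
  rewrite leq_eqVlt => /orP[/eqP -> //|ik kq].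
  apply: le_trans (IH ik (ltnW kq)) _; apply: le_trans (f_step _ (ltnW kq)).
  by rewrite ler_peMr ?g_ge1 // ltW // f_gt0 // ltnW.
have E_gt1 w : w \in E -> 1 < w.
  by move=> /imfsetP[k _ ->] /=; rewrite ltr_pdivlMr ?mul1r ?g_step ?g_gt0 // ltnW.
have window (i : 'I_q) w : w \in E -> w <= g i.+1 / g i -> g i < g i * w <= g i.+1.
  move=> wE; rewrite ler_pdivlMr ?g_gt0 1?ltnW // mulrC => ->.
  by rewrite ltr_pMr ?E_gt1 ?g_gt0 // ltnW.
(* The triples (j, i, w) counted by the left-hand side, to be mapped injectively into [K]. *)
pose S := [set t : 'I_q * ('I_q * E) | fsval t.2.2 <= g t.2.1.+1 / g t.2.1].
have -> : (q * \sum_(i < q) rank E (g i.+1 / g i) = #|S|)%N.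
  rewrite -sum1_card (eq_bigl (fun t : 'I_q * ('I_q * E) =>
      true && (fsval t.2.2 <= g t.2.1.+1 / g t.2.1))); last by move=> t; rewrite inE.
  rewrite -(pair_big_dep predT (fun (_ : 'I_q) (u : 'I_q * E) => fsval u.2 <= g u.1.+1 / g u.1) (fun _ _ => 1%N)) /=.
  rewrite sum_nat_const card_ord; congr (q * _)%N.
  rewrite -(pair_big_dep predT (fun (i : 'I_q) (w : E) => fsval w <= g i.+1 / g i) (fun _ _ => 1%N)) /=.
  by apply: eq_bigr => i _; rewrite sum1dep_card.
pose F (t : 'I_q * ('I_q * E)) := f t.1 * (g t.2.1 * fsval t.2.2).
have F_inj : {in S &, injective F}.
  move=> [j [i w]] [j' [i' w']]; rewrite !inE /F /= => le_w le_w' eqF.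
  have /andP[lo hi] := window i _ (fsvalP w) le_w.
  have /andP[lo' hi'] := window i' _ (fsvalP w') le_w'.
  (* The chain is f a * u <= f a * g q <= f a.+1 <= f b < f b * v. *)
  have sep (a b : 'I_q) (u v : R) : 1 < v -> u <= g q -> (a < b)%N -> f a * u < f b * v.
    move=> v1 ug ab.
    have fb : 0 < f b by apply: f_gt0.
    apply: le_lt_trans (_ : f b < _); last by rewrite ltr_pMr.
    apply: le_trans (f_mono _ _ ab (ltn_ord b)); apply: le_trans (f_step _ (ltn_ord a)).
    by rewrite ler_pM2l // f_gt0.
  have eqj : j = j'.
    apply/val_inj; case: (ltngtP j j') => //= jj.
    - suff: f j * (g i * fsval w) < f j' * (g i' * fsval w') by rewrite eqF ltxx.
      apply: sep => //; last by apply: le_trans hi (g_mono _ _ _ _).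
      by apply: le_lt_trans lo'; apply/g_ge1/ltnW.
    - suff: f j' * (g i' * fsval w') < f j * (g i * fsval w) by rewrite eqF ltxx.
      apply: sep => //; last by apply: le_trans hi' (g_mono _ _ _ _).
      by apply: le_lt_trans lo; apply/g_ge1/ltnW.
  rewrite -eqj in eqF *; have {}eqF := mulfI (lt0r_neq0 (f_gt0 _ (ltn_ord j))) eqF.
  have eqi : i = i'.
    apply/val_inj; case: (ltngtP i i') => //= ii.
    - have := le_lt_trans (le_trans hi (g_mono _ _ ii (ltnW (ltn_ord i')))) lo'.
      by rewrite eqF ltxx.
    - have := le_lt_trans (le_trans hi' (g_mono _ _ ii (ltnW (ltn_ord i)))) lo.
      by rewrite eqF ltxx.
  rewrite -eqi in eqF *; congr (_, (_, _)); apply: val_inj.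
  exact: mulfI (lt0r_neq0 (g_gt0 _ (ltnW (ltn_ord i)))) _ _ eqF.
have -> : #|S| = #|` [fset F t | t in S]|.
  by rewrite card_in_imfset //= -?cardE //; move=> t u tS uS; apply: F_inj.
apply: fsubset_leq_card; apply/fsubsetP => _ /imfsetP[[j [i w]] /= _ ->].
rewrite /F /= mulrA; have /imfsetP[k _ ->] := fsvalP w.
exact: inK.
Qed.

End Rank.

(** * Quotients of two shifts as functions of the point *)

Section Shifts.
Variable R : realType.
Implicit Types (z u x y : R) (X : {fset R}).

(** The function G_u of the overview, with the base parameter [z] made explicit. *)
Definition shift_ratio z u x := (u * x + 1) / (z * x + 1).

Lemma shift_ratio_lt z u x y :
  0 < z -> z < u -> 0 < x -> x < y -> shift_ratio z u x < shift_ratio z u y.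
Proof.
move=> z0 zu x0 xy; rewrite /shift_ratio.
have zx : 0 < z * x + 1 by nra.
have zy : 0 < z * y + 1 by nra.
by rewrite ltr_pdivrMr // mulrAC ltr_pdivlMr //; nra.
Qed.

Lemma shift_ratio_ge1 z u x :
  0 < z -> z < u -> 0 < x -> 1 <= shift_ratio z u x.
Proof.
move=> z0 zu x0; have zx : 0 < z * x + 1 by nra.
by rewrite /shift_ratio ler_pdivlMr //; nra.
Qed.

(* [shift_ratio z v] is a nontrivial affine function of [shift_ratio z u]
   fixing 1, so equal quotients for both force [x = x']. *)
Lemma shift_ratio_pair_inj z u v x y x' y' :
  0 < z -> z < u -> u < v -> 0 < x -> x < y -> 0 < x' -> x' < y' ->
  shift_ratio z u y / shift_ratio z u x = shift_ratio z u y' / shift_ratio z u x' ->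
  shift_ratio z v y / shift_ratio z v x = shift_ratio z v y' / shift_ratio z v x' ->
  x = x'.
Proof.
move=> z0 zu uv x0 xy x'0 x'y'.
have y0 := lt_trans x0 xy; have y'0 := lt_trans x'0 x'y'.
have zv := lt_trans zu uv.
(* Since G_u(t) - 1 = (u - z) t / (z t + 1), this is the constant ratio of G_v - 1 to G_u - 1. *)
pose a := (v - z) / (u - z).
have affine t : 0 < t -> shift_ratio z v t = a * shift_ratio z u t + (1 - a).
  move=> t0; rewrite /shift_ratio /a; field.
  by apply/andP; split; apply: lt0r_neq0; nra.
have a1 : 1 < a by rewrite /a ltr_pdivlMr; lra.
rewrite !affine //.
have gt0 t : 0 < t -> 0 < a * shift_ratio z u t + (1 - a).
  by move=> t0; have := shift_ratio_ge1 z0 zu t0; nra.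
have Gge t := @shift_ratio_ge1 z u t z0 zu.
have lt1 := shift_ratio_lt z0 zu x0 xy.
have mono : shift_ratio z u x = shift_ratio z u x' -> x = x'.
  by case: (ltgtP x x') => // lt;
    [have := shift_ratio_lt z0 zu x0 lt | have := shift_ratio_lt z0 zu x'0 lt]; lra.
move: (Gge _ x0) (Gge _ x'0) (gt0 _ x0) (gt0 _ x'0).
set p := shift_ratio z u x in lt1 mono *; set p' := shift_ratio z u x' in mono *.
set r := shift_ratio z u y in lt1 *; set r' := shift_ratio z u y'.
move=> p1 p'1 /lt0r_neq0 v0 /lt0r_neq0 v'0.
have /lt0r_neq0 p0 : 0 < p by lra.
have /lt0r_neq0 p'0 : 0 < p' by lra.
move=> /eqP; rewrite eqr_div // => /eqP eq1 /eqP; rewrite eqr_div // => /eqP eq2.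
apply: mono.
(* The right side combines the two cross-multiplied equations, so it vanishes; as a > 1 and p < r,
   only p' = p remains. *)
have : a * (1 - a) * ((r - p) * (p' - p))
    = (p * a ^+ 2 + a * (1 - a)) * (r * p' - r' * p)
      - p * ((a * r + (1 - a)) * (a * p' + (1 - a))
             - (a * r' + (1 - a)) * (a * p + (1 - a))) by ring.
rewrite eq1 eq2 !subrr !mulr0 subr0.
clearbody a p p' r r'.
move=> /eqP; rewrite !mulf_eq0 => /orP[/orP[]|/orP[]] /eqP ?; lra.
Qed.

End Shifts.

(** * Growth of the quotient set for a well-chosen pair of shifts *)

Section Expander.
Variable R : realType.
Implicit Types (z u x : R) (X : {fset R}).

Definition expander z u X : {fset R} :=
  ratio_set (prod_set (kfold_prod_set (affine_image z X) 2)
                      (kfold_prod_set (affine_image u X) 2))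
            (prod_set (kfold_prod_set (affine_image z X) 2)
                      (affine_image u X)).

(** Dividing by [shift_ratio z u c] puts z c + 1 above and u c + 1 below, so the numerator has two
    factors of each shift and the denominator two for [z] and one for [u]. *)
Lemma mem_expander z u X a b c d : 0 < z -> 0 < u ->
  (forall x, x \in X -> 0 < x) ->
  a \in X -> b \in X -> c \in X -> d \in X ->
  (z * a + 1) * shift_ratio z u b * (shift_ratio z u d / shift_ratio z u c)
    \in expander z u X.
Proof.
move=> z0 u0 X0 aX bX cX dX.
have mem y t : t \in X -> y * t + 1 \in affine_image y X.
  by move=> tX; apply/imfsetP; exists t.
have pos y t : 0 < y -> t \in X -> y * t + 1 != 0.
  by move=> y0 /X0 t0; apply: lt0r_neq0; nra.
have pm (A B : {fset R}) s t : s \in A -> t \in B -> s * t \in prod_set A B.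
  by move=> sA tB; apply/imfset2P; exists s => //; exists t.
rewrite /expander !kfold_prod_set2.
apply/imfset2P; exists ((z * a + 1) * (z * c + 1) * ((u * b + 1) * (u * d + 1))).
  by apply/pm; apply/pm; apply/mem.
exists ((z * b + 1) * (z * d + 1) * (u * c + 1)).
  by apply/pm; first apply/pm; apply/mem.
by rewrite /shift_ratio; field; rewrite !pos.
Qed.

(** The larger of the two rank sums, for G_u and G_w, is at least q (s+1) / 4, and [squeeze] gains a
    further factor q. With [s] of order q^(1/2) this yields order q^(5/2). *)
Lemma expander_growth (q s : nat) X :
  (forall x, x \in X -> 0 < x) -> (0 < q)%N -> (4 * q < #|` X|)%N ->
  (2 * s ^ 2 <= q)%N ->
  exists z u : R, [/\ z \in X, u \in X & (q * (q * s.+1) <= 4 * #|` expander z u X|)%N].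
Proof.
move=> X0 q0 qX sq.
(* Even positions only; 4 q < |X| ensures that x_0, ..., x_(2q) all exist. *)
pose S := sort <=%O (X : seq R); pose x i := nth 0 S (2 * i)%N.
have sizeS : size S = #|` X| by rewrite size_sort.
have S_in i : (i < #|` X|)%N -> nth 0 S i \in X.
  by move=> iX; rewrite -(mem_sort <=%O) mem_nth // sizeS.
have S_lt i k : (i < k)%N -> (k < #|` X|)%N -> nth 0 S i < nth 0 S k.
  move=> ik kX; have sorted_S : sorted <%O S by rewrite sort_lt_sorted fset_uniq.
  by apply: (sorted_ltn_nth lt_trans) => //; rewrite inE sizeS // (ltn_trans ik).
have x_in i : (i <= 2 * q)%N -> x i \in X by move=> iq; apply: S_in; lia.
have x_gt0 i : (i <= 2 * q)%N -> 0 < x i by move=> /x_in/X0.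
have x_lt i k : (i < k)%N -> (k <= 2 * q)%N -> x i < x k.
  by move=> ik kq; apply: S_lt; lia.
have q20 : (0 < 2 * q)%N by lia.
pose i0 := [arg min_(i < Ordinal q20) (x i.+1 / x i)]%O.
have i0_min i : (i < 2 * q)%N -> x i0.+1 / x i0 <= x i.+1 / x i.
  by move=> iq; rewrite /i0; case: arg_minP => // m _ /(_ (Ordinal iq) isT).
have i0q : (i0 < 2 * q)%N by exact: ltn_ord.
set z := x i0 in i0_min; pose u := nth 0 S (2 * i0).+1.
set w := x i0.+1 in i0_min.
have zX : z \in X by apply: x_in; lia.
have uX : u \in X by apply: S_in; lia.
have wX : w \in X by apply: x_in; lia.
have zu : z < u by apply: S_lt; lia.
have uw : u < w by apply: S_lt; lia.
have z0 := X0 _ zX.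
pose g v i := shift_ratio z v (x i).
pose e v (i : 'I_q) := g v i.+1 / g v i.
have grow v : v \in X -> z < v -> v <= w ->
  (q * \sum_i rank [fset e v k | k : 'I_q] (e v i) <= #|` expander z v X|)%N.
  move=> vX zv vw.
  (* The windows [f] use the upper half of the x_i and [g] the lower half, so that g q <=
     G_v(x_(q+j)) for every j. *)
  apply: (@squeeze R q (fun j => z * x (q + j)%N + 1) (g v)).
  - by move=> j jq; rewrite addr_gt0 // mulr_gt0 // x_gt0 //; lia.
  - move=> j jq; have xj : 0 < x (q + j)%N by apply: x_gt0; lia.
    apply: le_trans (_ : v * x (q + j)%N + 1 <= _); last first.
      (* Minimality of w/z gives w x_(q+j) <= z x_(q+j+1), and v <= w. *)
      have /i0_min : (q + j < 2 * q)%N by lia.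
      rewrite ler_pdivlMr // mulrAC ler_pdivrMr // -addnS => le.
      by rewrite lerD2r [leRHS]mulrC; apply: le_trans le; rewrite ler_pM2r.
    have -> : v * x (q + j)%N + 1 = (z * x (q + j)%N + 1) * g v (q + j)%N.
      by rewrite /g /shift_ratio [RHS]mulrC divfK //; apply: lt0r_neq0; nra.
    rewrite ler_pM2l; last by nra.
    case: j jq xj => [|j] jq xj; first by rewrite addn0.
    by apply/ltW/shift_ratio_lt => //; [apply: x_gt0 | apply: x_lt]; lia.
  - by apply: shift_ratio_ge1 => //; apply: x_gt0.
  - by move=> i iq; apply: shift_ratio_lt => //; [apply: x_gt0 | apply: x_lt]; lia.
  - move=> j i k jq iq kq.
    by apply: mem_expander => //; [exact: X0 | | | |]; apply: x_in; lia.
have grow_u := grow u uX zu (ltW uw).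
have grow_w := grow w wX (lt_trans zu uw) (lexx w).
have inj_e : injective (fun i => (e u i, e w i)).
  move=> i k [equ eqw]; apply: val_inj; have iq := ltn_ord i; have kq := ltn_ord k.
  have xik : x i = x k.
    apply: (shift_ratio_pair_inj z0 zu uw _ _ _ _ equ eqw).
    - by apply: x_gt0; lia.
    - by apply: x_lt; lia.
    - by apply: x_gt0; lia.
    - by apply: x_lt; lia.
  have kq2 : (k <= 2 * q)%N by lia.
  have iq2 : (i <= 2 * q)%N by lia.
  by case: (ltngtP i k) => // lt; [have := x_lt _ _ lt kq2 | have := x_lt _ _ lt iq2];
    rewrite xik ltxx.
have := sum_rank_ge inj_e sq; move: grow_u grow_w.
set a := (\sum_i _)%N; set b := (\sum_i _)%N => ha hb.
have : (a + b <= 2 * maxn a b)%N by lia.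
case: (leqP a b) => ab hm hs.
  exists z, w; split=> //; nia.
exists z, u; split=> //; nia.
Qed.

End Expander.

(** * Choice of parameters and passage to the exponent 5/2 *)

Theorem theorem1p2 (R : realType) :
  exists C c : R, 0 < C /\ 0 < c /\
    forall X : {fset R},
      (forall x : R, x \in X -> 0 < x) ->
      (2 <= #|` X|)%N ->
      exists z z' : R, z \in X /\ z' \in X /\
        gtrsim C c
          (#|` ratio_set
                 (prod_set (kfold_prod_set (affine_image z X) 2)
                           (kfold_prod_set (affine_image z' X) 2))
                 (prod_set (kfold_prod_set (affine_image z X) 2)
                           (affine_image z' X))|%:R)
          ((#|` X|%:R) `^ (5 / 2)).
Proof.
exists (1 / 1024), 1; split; [lra | split; first lra].
move=> X X0 X2; set N := #|` X| in X2 *.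
(* The square of N^(5/2) <= 1024 K, stated in natural numbers. *)
have [z [z' [zX z'X growth]]] : exists z z' : R,
    [/\ z \in X, z' \in X & (N ^ 5 <= 2 ^ 20 * #|` expander z z' X| ^ 2)%N].
  (* For N <= 4 a nonempty set suffices, because N^5 <= 2^10. *)
  have [N4|N4] := leqP N 4.
    have /fset0Pn[x xX] : X != fset0 by rewrite -cardfs_gt0; lia.
    exists x, x; split=> //; have x0 := X0 _ xX.
    have : (0 < #|` expander x x X|)%N.
      by rewrite cardfs_gt0; apply/fset0Pn; eexists; apply: (mem_expander x0 x0 X0 xX xX xX xX).
    move=> K0; apply: (@leq_trans (2 ^ 10)); first by rewrite (expnM 2 2 5) leq_exp2r.
    by apply: (@leq_trans (2 ^ 20)); rewrite ?leq_exp2l // leq_pmulr // expn_gt0 K0.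
  pose q := ((N - 1) %/ 4)%N.
  have [q0 qN Nq] : [/\ 0 < q, 4 * q < N & N <= 8 * q]%N by rewrite /q; split; lia.
  have exs : exists s, (2 * s ^ 2 <= q)%N by exists 0%N.
  have bds s : (2 * s ^ 2 <= q)%N -> (s <= q)%N by nia.
  case: (ex_maxnP exs bds) => s sq smax.
  have s1 : (q < 2 * s.+1 ^ 2)%N by rewrite ltnNge; apply/negP => /smax; rewrite ltnn.
  have [z [u [zX uX]]] := expander_growth X0 q0 qN sq.
  set K := #|` _| => le_K; exists z, u; split=> //.
  (* Maximality of [s] gives q < 2 (s+1)^2. Then q^5 <= 2 (4K)^2 = 2^5 K^2 and N^5 <= 2^15 q^5
     combine to 2^20. *)
  have le1 : (q ^ 5 <= 2 * (q * (q * s.+1)) ^ 2)%N.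
    have -> : (2 * (q * (q * s.+1)) ^ 2 = q ^ 4 * (2 * s.+1 ^ 2))%N by ring.
    by rewrite expnSr leq_mul2l (ltnW s1) orbT.
  have le2 : ((q * (q * s.+1)) ^ 2 <= (2 ^ 2 * K) ^ 2)%N by rewrite leq_exp2r.
  have le3 : (N ^ 5 <= (2 ^ 3 * q) ^ 5)%N by rewrite leq_exp2r.
  apply: (leq_trans le3); rewrite expnMn.
  apply: (leq_trans (leq_mul (leqnn _) (leq_trans le1 (leq_mul (leqnn 2) le2)))).
  by rewrite expnMn mulnA mulnA -!expnM -expnSr -expnD.
exists z, z'; do 2!split=> //; rewrite /gtrsim -/(expander z z' X).
set K : nat := #|` _| in growth *.
set y := N%:R `^ (5 / 2).
have N_ge2 : 2 <= N%:R :> R by rewrite ler_nat.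
have ln2 : 0 < ln 2 :> R by rewrite ln_gt0 //; lra.
have log_ge1 : 1 <= log2 y.
  rewrite /log2 ler_pdivlMr // mul1r /y ln_powR.
  have : ln 2 <= ln (N%:R) :> R by rewrite ler_ln ?posrE; lra.
  by nra.
rewrite powRr1; last lra.
have y_ge0 : 0 <= y by exact: powR_ge0.
(* As log2 y >= 1, dividing by it only decreases the bound. *)
apply: (@le_trans _ _ (1 / 1024 * y)).
  by rewrite ler_pdivrMr ?ler_peMr //; lra.
have y2 : y ^+ 2 = N%:R ^+ 5.
  rewrite /y -powR_mulrn // -powRrM -powR_mulrn; last by lra.
  by congr (_ `^ _); lra.
have : y ^+ 2 <= (1024 * K%:R) ^+ 2.
  apply: (@le_trans _ _ (2 ^ 20 * K ^ 2)%:R); first by rewrite y2 -natrX ler_nat.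
  by rewrite natrM !natrX exprMn ler_wpM2r ?exprn_ge0 //; lra.
rewrite ler_sqr ?nnegrE //; first by lra.
by rewrite mulr_ge0.
Qed.
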